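(* Let $R$ be a commutative ring with nonzero identity, $I$ an ideal of $R$, $M$ a unitary $R$-module and $P$ an $I$-primary submodule of $M$. Then: (i) If $N\subseteq P$ is a submodule of $M$, then $P/N$ is an $I$-primary submodule of $M/N$. (ii) Suppose that $S$ is a multiplicatively closed subset of $R$ such that $S^{-1}P\neq S^{-1}M$ and $S^{-1}(IP)\subseteq (S^{-1}I)(S^{-1}P)$. Then $S^{-1}P$ is an $(S^{-1}I)$-primary submodule of the $S^{-1}R$-module $S^{-1}M$.
   Context: For a commutative ring $A$, an ideal $J$ of $A$ and an $A$-module $X$, a proper submodule $Q$ of $X$ is called a $J$-primary submodule of $X$ if for all $a\in A$ and $x\in X$, $ax\in Q\setminus JQ$ implies $x\in Q$ or $a\in\sqrt{(Q:X)}$, where $(Q:X)=\{a\in A : aX\subseteq Q\}$ and $\sqrt{B}=\{a\in A : a^n\in B\text{ for some positive integer }n\}$ for an ideal $B$ of $A$. *)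

(* Defs.v *)
From HB Require Import structures.
From mathcomp Require Import all_boot all_algebra.
From mathcomp Require Import generic_quotient ring_quotient boolp ring.

Set Implicit Arguments.
Unset Strict Implicit.
Unset Printing Implicit Defensive.

Import GRing.Theory.
Local Open Scope ring_scope.
Local Open Scope quotient_scope.

(* Submodules are bundled boolean predicates [submodClosed X]; since classical
   logic is available ([asbool], written `[< _ >]), every subset is of this
   form.  An ideal of [A] is a submodule of the regular module [A^o]:
   MathComp's [idealr] would exclude the unit ideal.  Rings are [comPzRingType]
   because a ring of fractions may be zero. *)

Section Primary.
Variables (A : comPzRingType) (X : lmodType A).

Section IdealMul.
Variables (J : submodClosed A^o) (Q : submodClosed X).

Definition ideal_mul : {pred X} := [pred y : X | `[<
  exists (n : nat) (a : 'I_n -> A) (x : 'I_n -> X),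
    [/\ forall i, a i \in J, forall i, x i \in Q
      & y = \sum_(i < n) a i *: x i] >]].

Lemma ideal_mul_closed : submod_closed ideal_mul.
Proof.
split=> [|c y z].
  apply/asboolP; exists 0, (fun=> 0), (fun=> 0).
  by split=> [[]|[]|] //; rewrite big_ord0.
move=> /asboolP[m [a [x [aJ xQ ->]]]] /asboolP[n [b [w [bJ wQ ->]]]].
pose f T (g : 'I_m -> T) (h : 'I_n -> T) (i : 'I_(m + n)) :=
  match split i with inl j => g j | inr j => h j end.
apply/asboolP; exists (m + n), (f _ (fun i => c * a i) b), (f _ x w); split.
- move=> i; rewrite /f; case: (split i) => j //.
  exact: (@rpredZ A A^o J c (a j) (aJ j)).
- by move=> i; rewrite /f; case: (split i).
rewrite big_split_ord scaler_sumr; congr (_ + _); apply: eq_bigr => i _.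
  by rewrite /f (unsplitK (inl i)) scalerA.
by rewrite /f (unsplitK (inr i)).
Qed.

HB.instance Definition _ :=
  GRing.isSubmodClosed.Build A X ideal_mul ideal_mul_closed.

End IdealMul.

Definition colon (Q : submodClosed X) : {pred A} :=
  [pred a : A | `[< forall x : X, a *: x \in Q >]].

Definition radical (B : {pred A}) : {pred A} :=
  [pred a : A | `[< exists2 n : nat, (0 < n)%N & a ^+ n \in B >]].

Definition proper_submod (Q : submodClosed X) : Prop :=
  ~ (forall x : X, x \in Q).

Definition primary_submod (J : submodClosed A^o) (Q : submodClosed X) : Prop :=
  proper_submod Q /\
  forall (a : A) (x : X),
    a *: x \in Q -> a *: x \notin ideal_mul J Q ->
    x \in Q \/ a \in radical (colon Q).

End Primary.

Section QuotientModule.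
Variables (A : comPzRingType) (X : lmodType A) (N : submodClosed X).

(* [submodClosed] does not record closure under opposite, which the library
   quotient of a [zmodType] requires. *)
Definition submod_pred : {pred X} := N.

Lemma submod_pred_zmod : zmod_closed submod_pred.
Proof. exact: GRing.submod_closedB (submodClosedP N). Qed.

HB.instance Definition _ := GRing.isZmodClosed.Build X submod_pred
  submod_pred_zmod.

Definition quot_mod : Type := Quotient.quot submod_pred.

HB.instance Definition _ := GRing.Zmodule.on quot_mod.
HB.instance Definition _ := EqQuotient.on quot_mod.

Definition quot_proj (x : X) : quot_mod := \pi_(Quotient.quot submod_pred) x.

Lemma quot_proj_eq x y : quot_proj x = quot_proj y <-> x - y \in N.
Proof.
split=> [/eqP|xy].
  by rewrite -[_ == _]/(x == y %[mod Quotient.quot submod_pred])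
     -Quotient.idealrBE.
by apply/eqP; rewrite -[_ == _]/(x == y %[mod Quotient.quot submod_pred])
  -Quotient.idealrBE.
Qed.

Lemma quot_projK (y : quot_mod) :
  quot_proj (repr (y : Quotient.quot submod_pred)) = y.
Proof. exact: reprK. Qed.

Lemma quot_projD x y : quot_proj (x + y) = quot_proj x + quot_proj y.
Proof. by rewrite /quot_proj [LHS]Quotient.pi_add. Qed.

Definition quot_scale (a : A) (y : quot_mod) : quot_mod :=
  quot_proj (a *: repr (y : Quotient.quot submod_pred)).

Lemma quot_scale_proj a x : quot_scale a (quot_proj x) = quot_proj (a *: x).
Proof.
apply/quot_proj_eq; rewrite -scalerBr; apply: rpredZ.
by apply/quot_proj_eq; rewrite quot_projK.
Qed.

Lemma quot_scalerA a b v :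
  quot_scale a (quot_scale b v) = quot_scale (a * b) v.
Proof. by rewrite -(quot_projK v) !quot_scale_proj scalerA. Qed.

Lemma quot_scale1r : left_id 1 quot_scale.
Proof. by move=> v; rewrite -(quot_projK v) quot_scale_proj scale1r. Qed.

Lemma quot_scalerDr : right_distributive quot_scale +%R.
Proof.
move=> a u v; rewrite -(quot_projK u) -(quot_projK v).
by rewrite -quot_projD !quot_scale_proj scalerDr quot_projD.
Qed.

Lemma quot_scalerDl v : {morph quot_scale^~ v : a b / a + b}.
Proof.
by move=> a b; rewrite -(quot_projK v) !quot_scale_proj scalerDl quot_projD.
Qed.

HB.instance Definition _ := GRing.Zmodule_isLmodule.Build A quot_mod
  quot_scalerA quot_scale1r quot_scalerDr quot_scalerDl.

Lemma quot_projZ a x : quot_proj (a *: x) = a *: quot_proj x.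
Proof. by rewrite -quot_scale_proj. Qed.

Section QuotSubmod.
Variable P : submodClosed X.

Definition quot_submod : {pred quot_mod} :=
  [pred y : quot_mod | `[< exists2 x : X, x \in P & y = quot_proj x >]].

Lemma quot_submod_closed : submod_closed quot_submod.
Proof.
split=> [|c _ _ /asboolP[x xP ->] /asboolP[y yP ->]]; apply/asboolP.
  exists 0; first exact: rpred0.
  by apply: (addIr (quot_proj 0)); rewrite -quot_projD !add0r.
exists (c *: x + y); last by rewrite quot_projD quot_projZ.
by apply: rpredD => //; apply: rpredZ.
Qed.

HB.instance Definition _ :=
  GRing.isSubmodClosed.Build A quot_mod quot_submod quot_submod_closed.

End QuotSubmod.
End QuotientModule.

(* [mulrClosed A] is the type of multiplicatively closed subsets, which contain 1;
   0 is allowed as a denominator. *)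
Section Denominators.
Variables (A : comPzRingType) (S : mulrClosed A).

Definition denom : Type := {s : A | s \in S}.
HB.instance Definition _ := Choice.on denom.

Definition dval (s : denom) : A := sval s.

Definition denom1 : denom := exist _ 1 (rpred1 S).
Definition denomM (s t : denom) : denom :=
  exist _ (dval s * dval t) (rpredM (svalP s) (svalP t)).

Lemma denom1E : dval denom1 = 1. Proof. by []. Qed.
Lemma denomME s t : dval (denomM s t) = dval s * dval t. Proof. by []. Qed.
Lemma denomP (s : denom) : dval s \in S. Proof. exact: (svalP s). Qed.

End Denominators.

Arguments dval : simpl never.

Section LocalizedModule.
Variables (A : comPzRingType) (S : mulrClosed A) (X : lmodType A).
Local Notation D := (denom S).

Definition loc_rel (p q : X * D) : bool :=
  `[< exists u : D,
      dval u *: (dval q.2 *: p.1) = dval u *: (dval p.2 *: q.1) >].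

Lemma loc_rel_equiv : equiv_class_of loc_rel.
Proof.
split=> [[x s]|[x s] [y t]|[y t] [x s] [z r]].
- by apply/asboolP; exists (denom1 S).
- by apply/asboolP/asboolP => -[u e]; exists u.
move=> /asboolP[/= u eu] /asboolP[/= v ev]; apply/asboolP => /=.
exists (denomM (denomM u v) t); rewrite !denomME.
transitivity ((dval v * dval r) *: (dval u *: (dval t *: x))).
  by rewrite !scalerA; congr (_ *: _); ring.
rewrite eu; transitivity ((dval u * dval s) *: (dval v *: (dval r *: y))).
  by rewrite !scalerA; congr (_ *: _); ring.
by rewrite ev !scalerA; congr (_ *: _); ring.
Qed.

Canonical loc_equiv := EquivRelPack loc_rel_equiv.
Canonical loc_enc := defaultEncModRel loc_rel.

Definition loc_mod : Type := {eq_quot loc_rel}.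
HB.instance Definition _ := EqQuotient.on loc_mod.
HB.instance Definition _ := Choice.on loc_mod.

Definition loc_frac (x : X) (s : D) : loc_mod := \pi_loc_mod (x, s).

Lemma loc_fracP (x y : X) (s t : D) :
  loc_frac x s = loc_frac y t <->
  exists u : D, dval u *: (dval t *: x) = dval u *: (dval s *: y).
Proof.
by split=> [/eqmodP/asboolP|e] //; apply/eqmodP/asboolP.
Qed.

Lemma loc_fracK (p : loc_mod) : loc_frac (repr p).1 (repr p).2 = p.
Proof. by rewrite /loc_frac -surjective_pairing reprK. Qed.

Lemma loc_frac_ex (p : loc_mod) : exists x s, p = loc_frac x s.
Proof. by exists (repr p).1, (repr p).2; rewrite loc_fracK. Qed.

Definition loc_zero : loc_mod := loc_frac 0 (denom1 S).
Definition loc_opp (p : loc_mod) : loc_mod :=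
  loc_frac (- (repr p).1) (repr p).2.
Definition loc_add (p q : loc_mod) : loc_mod :=
  loc_frac (dval (repr q).2 *: (repr p).1 + dval (repr p).2 *: (repr q).1)
           (denomM (repr p).2 (repr q).2).

Lemma loc_oppE x s : loc_opp (loc_frac x s) = loc_frac (- x) s.
Proof.
have /loc_fracP[u e] := loc_fracK (loc_frac x s).
by apply/loc_fracP; exists u; rewrite !scalerN e.
Qed.

Lemma loc_addE x s y t : loc_add (loc_frac x s) (loc_frac y t) =
  loc_frac (dval t *: x + dval s *: y) (denomM s t).
Proof.
have /loc_fracP[u eu] := loc_fracK (loc_frac x s).
have /loc_fracP[v ev] := loc_fracK (loc_frac y t).
rewrite /loc_add; move: (repr _) (repr _) eu ev => [y' t'] [x' s'] /= eu ev.
apply/loc_fracP; exists (denomM u v); rewrite !denomME !scalerDr.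
congr (_ + _).
  transitivity ((dval v * dval t * dval t') *: (dval u *: (dval s *: x'))).
    by rewrite !scalerA; congr (_ *: _); ring.
  by rewrite eu !scalerA; congr (_ *: _); ring.
transitivity ((dval u * dval s * dval s') *: (dval v *: (dval t *: y'))).
  by rewrite !scalerA; congr (_ *: _); ring.
by rewrite ev !scalerA; congr (_ *: _); ring.
Qed.

Lemma loc_frac_eq x s y t : dval t *: x = dval s *: y ->
  loc_frac x s = loc_frac y t.
Proof. by move=> e; apply/loc_fracP; exists (denom1 S); rewrite e. Qed.

Lemma loc_addA : associative loc_add.
Proof.
move=> p q r; rewrite -(loc_fracK p) -(loc_fracK q) -(loc_fracK r) !loc_addE.
apply: loc_frac_eq; rewrite !denomME !scalerDr !addrA !scalerA.
by congr (_ *: _ + _ *: _ + _ *: _); ring.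
Qed.

Lemma loc_addC : commutative loc_add.
Proof.
move=> p q; rewrite -(loc_fracK p) -(loc_fracK q) !loc_addE.
apply: loc_frac_eq; rewrite !denomME !scalerDr addrC !scalerA.
by congr (_ *: _ + _ *: _); ring.
Qed.

Lemma loc_add0 : left_id loc_zero loc_add.
Proof.
move=> p; rewrite -(loc_fracK p) loc_addE.
by apply: loc_frac_eq; rewrite !denomME denom1E scaler0 add0r scale1r mul1r.
Qed.

Lemma loc_addN : left_inverse loc_zero loc_opp loc_add.
Proof.
move=> p; rewrite -(loc_fracK p) loc_oppE loc_addE.
by apply: loc_frac_eq; rewrite /= !scalerN addNr !scaler0.
Qed.

HB.instance Definition _ := GRing.isZmodule.Build loc_mod
  loc_addA loc_addC loc_add0 loc_addN.

Lemma loc_fracD x s y t : loc_frac x s + loc_frac y t =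
  loc_frac (dval t *: x + dval s *: y) (denomM s t).
Proof. exact: loc_addE. Qed.

End LocalizedModule.

Section LocalizedRing.
Variables (A : comPzRingType) (S : mulrClosed A).

Section Scale.
Variable X : lmodType A.

Definition loc_scale (c : loc_mod S A^o) (p : loc_mod S X) : loc_mod S X :=
  loc_frac (((repr c).1 : A) *: (repr p).1) (denomM (repr c).2 (repr p).2).

Lemma loc_scaleE (a : A) s x t :
  loc_scale (loc_frac (a : A^o) s) (loc_frac x t) =
  loc_frac (a *: x) (denomM s t).
Proof.
have /loc_fracP[u eu] := loc_fracK (loc_frac (a : A^o) s).
have /loc_fracP[v ev] := loc_fracK (loc_frac x t).
rewrite /loc_scale; move: (repr _) (repr _) eu ev => [x' t'] [a' s'] /= eu ev.
apply/loc_fracP; exists (denomM u v); rewrite !denomME.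
have {}eu : dval u * (dval s * a') = dval u * (dval s' * a) := eu.
transitivity ((dval u * (dval s * a')) *: (dval v *: (dval t *: x'))).
  by rewrite !scalerA; congr (_ *: _); ring.
by rewrite eu ev !scalerA; congr (_ *: _); ring.
Qed.

Lemma loc_scaleDr c : {morph loc_scale c : p q / p + q}.
Proof.
move=> p q; rewrite -(loc_fracK p) -(loc_fracK q) -(loc_fracK c).
rewrite loc_fracD !loc_scaleE loc_fracD.
apply: loc_frac_eq; rewrite !denomME !scalerDr !scalerA.
by congr (_ *: _ + _ *: _); ring.
Qed.

Lemma loc_scaleDl p : {morph loc_scale^~ p : c d / c + d}.
Proof.
move=> c d; rewrite -(loc_fracK p) -(loc_fracK c) -(loc_fracK d).
rewrite loc_fracD !loc_scaleE loc_fracD.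
apply: loc_frac_eq; rewrite !denomME !scalerDl !scalerDr !scalerA.
by congr (_ *: _ + _ *: _); rewrite /GRing.scale /=; ring.
Qed.

Lemma loc_scale1 p : loc_scale (loc_frac (1 : A^o) (denom1 S)) p = p.
Proof.
rewrite -[in LHS](loc_fracK p) loc_scaleE scale1r -[RHS]loc_fracK.
by apply: loc_frac_eq; rewrite denomME mul1r.
Qed.

End Scale.

Definition loc_ring : Type := loc_mod S A^o.
HB.instance Definition _ := EqQuotient.on loc_ring.
HB.instance Definition _ := GRing.Zmodule.on loc_ring.

Definition loc_one : loc_ring := loc_frac (1 : A^o) (denom1 S).
Definition loc_mul (c d : loc_ring) : loc_ring := loc_scale c d.

Definition loc_num (a : A) (s : denom S) : loc_ring := loc_frac (a : A^o) s.

Lemma loc_num_ex (c : loc_ring) : exists (a : A) s, c = loc_num a s.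
Proof.
by have [a [s e]] := loc_frac_ex (c : loc_mod S A^o); exists a, s.
Qed.

Lemma loc_num_eq (a b : A) s t : dval t * a = dval s * b ->
  loc_num a s = loc_num b t.
Proof. exact: (@loc_frac_eq _ _ A^o). Qed.

Lemma loc_mulE (a b : A) s t :
  loc_mul (loc_num a s) (loc_num b t) = loc_num (a * b) (denomM s t).
Proof. exact: (@loc_scaleE A^o). Qed.

Lemma loc_scale_num (X : lmodType A) (a : A) s (x : X) t :
  loc_scale (loc_num a s) (loc_frac x t) = loc_frac (a *: x) (denomM s t).
Proof. exact: loc_scaleE. Qed.

Lemma loc_scaleA (X : lmodType A) (c d : loc_ring) (p : loc_mod S X) :
  loc_scale c (loc_scale d p) = loc_scale (loc_mul c d) p.
Proof.
have [[x [r ->]] [a [s ->]]] := (loc_frac_ex p, loc_num_ex c).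
have [b [t ->]] := loc_num_ex d; rewrite loc_mulE !loc_scale_num.
apply: loc_frac_eq; rewrite !denomME !scalerA.
by congr (_ *: _); ring.
Qed.

Lemma loc_mulA : associative loc_mul.
Proof. by move=> a b c; exact: loc_scaleA. Qed.

Lemma loc_mulC : commutative loc_mul.
Proof.
move=> c d; have [[a [s ->]] [b [t ->]]] := (loc_num_ex c, loc_num_ex d).
by rewrite !loc_mulE; apply: loc_num_eq; rewrite !denomME; ring.
Qed.

Lemma loc_mul1 : left_id loc_one loc_mul.
Proof. exact: loc_scale1. Qed.

Lemma loc_mulDl : left_distributive loc_mul +%R.
Proof. by move=> a b c; exact: loc_scaleDl. Qed.

HB.instance Definition _ := GRing.Zmodule_isComPzRing.Build loc_ring
  loc_mulA loc_mulC loc_mul1 loc_mulDl.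

HB.instance Definition _ (X : lmodType A) :=
  GRing.Zmodule_isLmodule.Build loc_ring (loc_mod S X)
    (@loc_scaleA X) (@loc_scale1 X) (@loc_scaleDr X) (@loc_scaleDl X).

Lemma loc_numZ (X : lmodType A) a s (x : X) t :
  loc_num a s *: loc_frac x t = loc_frac (a *: x) (denomM s t).
Proof. exact: loc_scaleE. Qed.

Lemma loc_numM a s b t :
  loc_num a s * loc_num b t = loc_num (a * b) (denomM s t).
Proof. exact: (@loc_scaleE A^o). Qed.

Lemma loc_numD a s b t : loc_num a s + loc_num b t =
  loc_num (dval t * a + dval s * b) (denomM s t).
Proof. exact: (@loc_fracD _ _ A^o). Qed.

Section LocSubmod.
Variables (X : lmodType A) (P : submodClosed X).

Definition loc_submod : {pred loc_mod S X} := [pred y : loc_mod S X |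
  `[< exists x (s : denom S), x \in P /\ y = loc_frac x s >]].

Lemma loc_submod_closed : submod_closed loc_submod.
Proof.
split=> [|c _ _ /asboolP[x [s [xP ->]]] /asboolP[y [t [yP ->]]]].
  by apply/asboolP; exists 0, (denom1 S); split; first exact: rpred0.
have [a [r ->]] := loc_num_ex c.
rewrite loc_numZ loc_fracD; apply/asboolP; eexists; eexists; split; last by [].
by apply: rpredD; apply: rpredZ => //; apply: rpredZ.
Qed.

HB.instance Definition _ := GRing.isSubmodClosed.Build loc_ring (loc_mod S X)
  loc_submod loc_submod_closed.

End LocSubmod.

(* [loc_submod S I] has the same elements, but it is a submodule of
   [loc_mod S A^o] and not of the regular module of [loc_ring]. *)
Section LocIdeal.
Variable I : submodClosed A^o.

Definition loc_ideal : {pred loc_ring^o} := [pred c : loc_ring^o |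
  `[< exists (a : A) (s : denom S), a \in I /\ c = loc_num a s >]].

Lemma loc_ideal_closed : submod_closed loc_ideal.
Proof. exact: (loc_submod_closed I). Qed.

HB.instance Definition _ := GRing.isSubmodClosed.Build loc_ring loc_ring^o
  loc_ideal loc_ideal_closed.

End LocIdeal.
End LocalizedRing.

Arguments quot_submod {A X} N P : rename.
Arguments loc_submod {A} S {X} P : rename.
Arguments loc_ideal {A} S I : rename.

(* Main.v *)
Require Import Defs.
From HB Require Import structures.
From mathcomp Require Import all_boot all_algebra.
From mathcomp Require Import boolp.
Import GRing.Theory.
Local Open Scope ring_scope.

(** Both parts pull the hypothesis on a product back to M, apply primariness of P there, and push
    the conclusion forward. For M/N, the inclusion of N in P makes membership in P/N reflect to P
    ([quot_proj_submod]), and the image of IP lies in I(P/N) ([quot_proj_ideal_mul]), so a product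
    avoiding I(P/N) lifts to one avoiding IP. For fractions, x/t lies in the localized P exactly
    when some u in S has ux in P ([loc_frac_submod]). If (a/s)(x/t) lies there, then a(ux) is in P
    for some u, and it avoids IP by the assumed inclusion; primariness for a and ux gives ux in P,
    or a power of a sending M into P. *)

(** A representative of a class in P/N differs from an element of P by an element of N, hence of
    P. *)
Lemma quot_proj_submod (A : comPzRingType) (X : lmodType A)
    (N P : submodClosed X) :
  {subset N <= P} ->
  forall x : X, quot_proj N x \in quot_submod N P -> x \in P.
Proof.
move=> sNP x /asboolP[p pP /quot_proj_eq/sNP xpP].
by rewrite -(subrK p x) rpredD.
Qed.

Lemma quot_proj_ideal_mul (A : comPzRingType) (X : lmodType A)
    (J : submodClosed A^o) (N P : submodClosed X) (x : X) :
  x \in ideal_mul J P -> quot_proj N x \in ideal_mul J (quot_submod N P).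
Proof.
move=> /asboolP[n [a [y [aJ yP ->]]]]; apply/asboolP.
exists n, a, (fun i => quot_proj N (y i)); split=> //.
  by move=> i; apply/asboolP; exists (y i).
(* [big_morph] needs the value at 0, which additivity forces by cancellation. *)
have proj0 : quot_proj N 0 = 0.
  by apply: (addIr (quot_proj N 0)); rewrite -quot_projD !add0r.
rewrite (big_morph _ (quot_projD N) proj0).
by apply: eq_bigr => i _; rewrite quot_projZ.
Qed.

Lemma quot_submod_primary (A : comPzRingType) (X : lmodType A)
    (J : submodClosed A^o) (N P : submodClosed X) :
  {subset N <= P} -> primary_submod J P -> primary_submod J (quot_submod N P).
Proof.
move=> sNP [properP primP]; split=> [allP|a y].
  by apply: properP => x; apply: (quot_proj_submod _ _ _ _ sNP).
rewrite -(quot_projK y); move: (repr _) => x.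
rewrite -quot_projZ => /(quot_proj_submod _ _ _ _ sNP) axP axJP.
have {}axJP : a *: x \notin ideal_mul J P.
  by apply: contra axJP; apply: quot_proj_ideal_mul.
have [xP|/asboolP[n n_gt0 /asboolP anP]] := primP a x axP axJP.
  by left; apply/asboolP; exists x.
right; apply/asboolP; exists n => //; apply/asboolP => z.
rewrite -(quot_projK z); move: (repr _) => w.
by rewrite -quot_projZ; apply/asboolP; exists (a ^+ n *: w).
Qed.

(** Equality of fractions holds only up to a factor from S, so the numerator itself may lie outside
    P. *)
Lemma loc_frac_submod (A : comPzRingType) (S : mulrClosed A) (X : lmodType A)
    (P : submodClosed X) (x : X) (s : denom S) :
  loc_frac x s \in loc_submod S P <-> exists u : denom S, dval u *: x \in P.
Proof.
split=> [/asboolP[p [t [pP /loc_fracP[u e]]]]|[u uxP]].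
  exists (denomM u t); rewrite denomME -scalerA e.
  by do 2!apply: rpredZ.
(* Expand the fraction by u: x/s = (ux)/(us). *)
apply/asboolP; exists (dval u *: x), (denomM u s); split=> //.
by apply: loc_frac_eq; rewrite denomME scalerA mulrC.
Qed.

(** The denominator is left unspecified: only the numerator decides whether the power sends the
    module into the localized P. *)
Lemma loc_numX (A : comPzRingType) (S : mulrClosed A) (a : A) (s : denom S)
    (n : nat) :
  exists t : denom S, loc_num a s ^+ n = loc_num (a ^+ n) t.
Proof.
elim: n => [|n [t IHn]]; first by exists (denom1 S).
by exists (denomM s t); rewrite !exprS IHn loc_numM.
Qed.

Lemma loc_submod_primary (A : comPzRingType) (S : mulrClosed A)
    (X : lmodType A) (J : submodClosed A^o) (P : submodClosed X) :
  primary_submod J P -> proper_submod (loc_submod S P) ->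
  {subset loc_submod S (ideal_mul J P) <=
          ideal_mul (loc_ideal S J) (loc_submod S P)} ->
  primary_submod (loc_ideal S J) (loc_submod S P).
Proof.
move=> [_ primP] properSP subSJP; split=> // c y.
have [[x [t ->]] [a [s ->]]] := (loc_frac_ex y, loc_num_ex c).
rewrite loc_numZ => /loc_frac_submod[u uaxP] axJP.
(* The factor u is moved onto x, so that primariness speaks of a itself and not of ua. *)
have auxE : a *: (dval u *: x) = dval u *: (a *: x).
  by rewrite !scalerA mulrC.
have auxP : a *: (dval u *: x) \in P by rewrite auxE.
have auxJP : a *: (dval u *: x) \notin ideal_mul J P.
  apply: contra axJP => auxJ; apply: subSJP.
  by apply/loc_frac_submod; exists u; rewrite -auxE.
have [uxP|/asboolP[n n_gt0 /asboolP anP]] := primP _ _ auxP auxJP.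
  by left; apply/loc_frac_submod; exists u.
right; apply/asboolP; exists n => //; apply/asboolP => z.
have [[w [r ->]] [v ->]] := (loc_frac_ex z, loc_numX _ _ a s n).
rewrite loc_numZ; apply/asboolP; exists (a ^+ n *: w), (denomM v r).
by split; first exact: anP.
Qed.

Theorem theorem2p5 (R : comNzRingType) (I : submodClosed R^o)
    (M : lmodType R) (P : submodClosed M) (hP : primary_submod I P) :
  (forall N : submodClosed M, {subset N <= P} ->
     primary_submod I (quot_submod N P)) /\
  (forall S : mulrClosed R,
     proper_submod (loc_submod S P) ->
     {subset loc_submod S (ideal_mul I P) <=
             ideal_mul (loc_ideal S I) (loc_submod S P)} ->
     primary_submod (loc_ideal S I) (loc_submod S P)).
Proof.
split=> [N sNP|S properSP subSIP]; first exact: quot_submod_primary.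
exact: loc_submod_primary.
Qed.
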